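(* If $R$ is a right hereditary right small ring, then $R$ is right almost-$QF$.
   Context: Rings are associative with identity; modules are unital right modules. A right $R$-module $M$ is $R$-projective if for every right ideal $I$ of $R$, every homomorphism $M\to R/I$ factors through the canonical projection $R\to R/I$. A ring $R$ is right almost-$QF$ if every injective right $R$-module is $R$-projective. A submodule $K$ of $M$ is superfluous, written $K\ll M$, if $K+L\neq M$ for every proper submodule $L$ of $M$. $R$ is a right small ring if $R_R\ll E(R_R)$, where $E(R_R)$ is the injective hull of $R_R$. *)

(* Defs.v *)
From HB Require Import structures.
From mathcomp Require Import all_boot all_order all_algebra.
From mathcomp Require Import boolp.

Set Implicit Arguments.
Unset Strict Implicit.
Unset Printing Implicit Defensive.

Import GRing.Theory.
Local Open Scope ring_scope.
Local Open Scope quotient_scope.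

(* The library's modules are left modules.  A right module over R is a left
   module over the converse ring R^c; the right module R_R is R^c^o (lemma
   [regr_scaleE]), so that right ideals of R are the submodules of [regr R].
   Rings are [pzRingType]s, that is, the zero ring is allowed.
   Submodules are boolean predicates; classically ([boolp]) every subset is. *)
Notation rmodType R := (lmodType R^c).

Definition regr (R : pzRingType) : rmodType R := R^c^o.

Lemma regr_scaleE (R : pzRingType) (a x : R) :
  (a : R^c) *: (x : regr R) = x * a.
Proof. by []. Qed.

Notation right_ideal R := (submodClosed (regr R)).

Section Submodule.
Variables (S : pzRingType) (V : lmodType S) (N : submodClosed V).

Definition submod_type := {x : V | x \in N}.

HB.instance Definition _ := SubChoice.on submod_type.
HB.instance Definition _ := [SubChoice_isSubLmodule of submod_type by <:].

End Submodule.

Section QuotientModule.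
Variables (S : pzRingType) (V : lmodType S) (N : submodClosed V).

(* The library quotient [Quotient.quot] wants a [zmodClosed] predicate. *)
Definition submod_pred : {pred V} := N.

Fact submod_pred_zmod_closed : zmod_closed submod_pred.
Proof. exact: GRing.submod_closedB (submodClosedP N). Qed.

HB.instance Definition _ :=
  GRing.isZmodClosed.Build V submod_pred submod_pred_zmod_closed.

Definition quotmod := Quotient.quot submod_pred.

HB.instance Definition _ := GRing.Zmodule.on quotmod.

Definition quotmod_proj (x : V) : quotmod := \pi_(Quotient.quot submod_pred) x.

Lemma quotmod_proj_eq x y : (quotmod_proj x == quotmod_proj y) = (x - y \in N).
Proof. by rewrite /quotmod_proj -Quotient.idealrBE. Qed.

Lemma quotmod_proj_surj (y : quotmod) : exists x, quotmod_proj x = y.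
Proof. by exists (repr y); rewrite /quotmod_proj reprK. Qed.

Fact quotmod_proj_is_zmod_morphism : zmod_morphism quotmod_proj.
Proof. by move=> x y; rewrite /quotmod_proj raddfB. Qed.

HB.instance Definition _ := GRing.isZmodMorphism.Build V quotmod quotmod_proj
  quotmod_proj_is_zmod_morphism.

Definition quotmod_scale (a : S) (x : quotmod) : quotmod :=
  quotmod_proj (a *: repr x).

Lemma quotmod_scale_proj a x :
  quotmod_scale a (quotmod_proj x) = quotmod_proj (a *: x).
Proof.
apply/eqP; rewrite quotmod_proj_eq -scalerBr rpredZ //.
by rewrite -quotmod_proj_eq /quotmod_proj reprK.
Qed.

Fact quotmod_scaleA a b x :
  quotmod_scale a (quotmod_scale b x) = quotmod_scale (a * b) x.
Proof.
by have [y <-] := quotmod_proj_surj x; rewrite !quotmod_scale_proj scalerA.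
Qed.

Fact quotmod_scale1 : left_id 1 quotmod_scale.
Proof.
by move=> x; have [y <-] := quotmod_proj_surj x;
  rewrite quotmod_scale_proj scale1r.
Qed.

Fact quotmod_scaleDr : right_distributive quotmod_scale +%R.
Proof.
move=> a x y; have [x' <-] := quotmod_proj_surj x.
have [y' <-] := quotmod_proj_surj y.
by rewrite -raddfD !quotmod_scale_proj scalerDr raddfD.
Qed.

Fact quotmod_scaleDl x : {morph quotmod_scale^~ x : a b / a + b}.
Proof.
move=> a b; have [y <-] := quotmod_proj_surj x.
by rewrite !quotmod_scale_proj scalerDl raddfD.
Qed.

HB.instance Definition _ := GRing.Zmodule_isLmodule.Build S quotmod
  quotmod_scaleA quotmod_scale1 quotmod_scaleDr quotmod_scaleDl.

Fact quotmod_proj_is_scalable : scalable quotmod_proj.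
Proof. by move=> a x; rewrite -quotmod_scale_proj. Qed.

HB.instance Definition _ := GRing.isScalable.Build S V quotmod *:%R quotmod_proj
  quotmod_proj_is_scalable.

End QuotientModule.

Section LinearRange.
Variables (S : pzRingType) (V W : lmodType S) (f : {linear V -> W}).

Definition lrange : {pred W} := fun y => `[< exists x, f x = y >].

Lemma lrangeP y : reflect (exists x, f x = y) (y \in lrange).
Proof. exact: asboolP. Qed.

Fact lrange_submod_closed : submod_closed lrange.
Proof.
split; first by apply/lrangeP; exists 0; rewrite linear0.
move=> a _ _ /lrangeP[x <-] /lrangeP[y <-]; apply/lrangeP.
by exists (a *: x + y); rewrite linearP.
Qed.

HB.instance Definition _ := GRing.isSubmodClosed.Build S W lrange
  lrange_submod_closed.

End LinearRange.

Section ModuleNotions.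
Variable S : pzRingType.
Implicit Types V : lmodType S.

Definition projective_mod V : Prop :=
  forall (A B : lmodType S) (p : {linear A -> B}) (f : {linear V -> B}),
    (forall b, exists a, p a = b) ->
    exists g : {linear V -> A}, forall x, p (g x) = f x.

Definition injective_mod V : Prop :=
  forall (A B : lmodType S) (i : {linear A -> B}) (f : {linear A -> V}),
    injective i ->
    exists g : {linear B -> V}, forall x, g (i x) = f x.

Definition superfluous V (K : submodClosed V) : Prop :=
  forall L : submodClosed V, (exists x, x \notin L) ->
    ~ (forall x, exists k l, [/\ k \in K, l \in L & x = k + l]).

Definition essential V (K : submodClosed V) : Prop :=
  forall L : submodClosed V, (exists2 x, x \in L & x != 0) ->
    exists x, [/\ x \in K, x \in L & x != 0].

(* The embedding i : V -> E exhibits E as an injective hull E(V) of V. *)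
Definition injective_hull V (E : lmodType S) (i : {linear V -> E}) : Prop :=
  [/\ injective_mod E, injective i & essential (lrange i)].

End ModuleNotions.

Section RingNotions.
Variable R : pzRingType.

Definition ring_projective (M : rmodType R) : Prop :=
  forall (I : right_ideal R) (f : {linear M -> quotmod I}),
    exists g : {linear M -> regr R}, forall x, quotmod_proj I (g x) = f x.

Definition right_almost_QF : Prop :=
  forall M : rmodType R, injective_mod M -> ring_projective M.

Definition right_hereditary : Prop :=
  forall I : right_ideal R, projective_mod (submod_type I).

(* The choice of the injective hull is irrelevant: see [right_small_ringP]. *)
Definition right_small_ring : Prop :=
  exists (E : rmodType R) (i : {linear regr R -> E}),
    injective_hull i /\ superfluous (lrange i).

End RingNotions.

Section LinearPreimage.
Variables (S : pzRingType) (V W : lmodType S) (f : {linear V -> W}).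
Variable N : submodClosed W.

Definition lpreim : {pred V} := fun x => f x \in N.

Lemma lpreimE x : (x \in lpreim) = (f x \in N).
Proof. by []. Qed.

Fact lpreim_submod_closed : submod_closed lpreim.
Proof.
split=> [|a x y]; rewrite !lpreimE ?linear0 ?rpred0 // => fx fy.
by rewrite linearP rpredD ?rpredZ.
Qed.

HB.instance Definition _ := GRing.isSubmodClosed.Build S V lpreim
  lpreim_submod_closed.

End LinearPreimage.

Lemma right_small_ringP (R : pzRingType) (E : rmodType R)
    (i : {linear regr R -> E}) :
  injective_hull i -> right_small_ring R <-> superfluous (lrange i).
Proof.
move=> hi; split=> [[E' [i' [[_ i'_inj _] i'_small]]]|i_small]; last first.
  by exists E, i.
have [E_inj _ _] := hi; have [g gi] := E_inj _ _ i' i i'_inj.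
move=> L [x xNL] sumL; have Lg y : g y \in L.
  apply/negbNE/negP=> yNL; apply: (i'_small (lpreim g L)); first by exists y.
  move=> z; have [_ [l [/lrangeP[r <-] lL gz]]] := sumL (g z).
  exists (i' r), (z - i' r); split; first by apply/lrangeP; exists r.
    by rewrite lpreimE linearB /= gi gz addrC addKr.
  by rewrite addrC subrK.
have [_ [l [/lrangeP[r <-] lL xE]]] := sumL x.
by case/negP: xNL; rewrite xE -gi rpredD.
Qed.

(* Main.v *)
Require Import Defs.
From mathcomp Require Import all_boot all_order all_algebra.
From HB Require Import structures.

(** The point is that every homomorphism f from an injective module M to a
    cyclic module R/I vanishes, so that it factors through R as zero.  Let J be
    the right ideal with J/I = f(M).  As J is projective, the projection
    J -> J/I = f(M) lifts along f to J -> M; as M is injective, this lift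
    extends along J <= R <= E(R) to g : E(R) -> M.  Now f \o g agrees with the
    projection on J and already maps J onto f(M), whence
    E(R) = J + ker (f \o g) = R + ker (f \o g).  Since R is superfluous in E(R),
    f \o g is zero, and therefore so is f(M) = (f \o g)(J).

    Lifting first and extending afterwards uses the injectivity of M itself:
    it spares the theorem that quotients of injective modules over a hereditary
    ring are injective, and with it Baer's criterion. *)

Set Implicit Arguments.
Unset Strict Implicit.
Unset Printing Implicit Defensive.

Import GRing.Theory.
Local Open Scope ring_scope.

Section Corestriction.
Variables (S : pzRingType) (V W : lmodType S) (f : {linear V -> W}).
Variables (N : submodClosed W) (fN : forall x, f x \in N).

Definition corestrict (x : V) : submod_type N := exist _ (f x) (fN x).

Fact corestrict_is_linear : linear corestrict.
Proof. by move=> a x y; apply: val_inj; rewrite [RHS]linearP /= linearP. Qed.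

HB.instance Definition _ := GRing.isLinear.Build S V (submod_type N) _
  corestrict corestrict_is_linear.

End Corestriction.

Section LinearKernel.
Variables (S : pzRingType) (V W : lmodType S) (f : {linear V -> W}).

Definition lkernel : {pred V} := fun x => f x == 0.

Lemma lkernelE x : (x \in lkernel) = (f x == 0).
Proof. by []. Qed.

Fact lkernel_submod_closed : submod_closed lkernel.
Proof.
split=> [|a x y]; rewrite !lkernelE ?linear0 // => /eqP fx /eqP fy.
by rewrite linearP fx fy scaler0 addr0.
Qed.

HB.instance Definition _ := GRing.isSubmodClosed.Build S V lkernel
  lkernel_submod_closed.

End LinearKernel.

(** Corestricting p and f to the range of p turns p into a surjection, to which
    projectivity applies. *)
Lemma projective_mod_lift_range (S : pzRingType) (P A B : lmodType S)
    (p : {linear A -> B}) (f : {linear P -> B}) :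
  projective_mod P -> (forall x, f x \in lrange p) ->
  exists g : {linear P -> A}, forall x, p (g x) = f x.
Proof.
move=> P_proj f_range.
have p_range a : p a \in lrange p by apply/lrangeP; exists a.
have [|g pg] := P_proj _ _ (corestrict p_range) (corestrict f_range).
  move=> b; have /lrangeP[a pa] := valP b.
  by exists a; apply: val_inj.
by exists g => x; have /(congr1 val) := pg x.
Qed.

(** If h maps K onto its whole range, then K and the kernel of h together span
    the module, so that the kernel is everything when K is superfluous. *)
Lemma superfluous_range_eq0 (S : pzRingType) (E W : lmodType S)
    (K : submodClosed E) (h : {linear E -> W}) :
  superfluous K -> (forall e, exists2 k, k \in K & h k = h e) ->
  forall e, h e = 0.
Proof.
move=> K_small h_onK e; apply/eqP/negbNE/negP => he_neq0.
apply: (K_small (lkernel h)); first by exists e; rewrite lkernelE.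
move=> x; have [k kK hk] := h_onK x; exists k, (x - k); split=> //.
  by rewrite lkernelE linearB /= hk subrr.
by rewrite addrC subrK.
Qed.

(** The lift k of the projection J -> f(M) comes from projectivity of J, its
    extension g to the hull from injectivity of M, and smallness kills f \o g
    because f \o g covers f(M) already on the image of R. *)
Lemma injective_to_cyclic_eq0 (R : pzRingType) (M : rmodType R)
    (I : right_ideal R) (f : {linear M -> quotmod I}) :
  right_hereditary R -> right_small_ring R -> injective_mod M ->
  forall x, f x = 0.
Proof.
move=> R_her [E [i [[_ i_inj _] i_small]]] M_inj.
pose J : right_ideal R := lpreim (quotmod_proj I) (lrange f).
pose incl : {linear submod_type J -> regr R} := val.
have [|k fk] := @projective_mod_lift_range _ _ _ _ f
  (quotmod_proj I \o incl) (R_her J); first by move=> x; exact: (valP x).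
have [|g gE] := M_inj _ _ (i \o incl) k.
  by apply: inj_comp i_inj _; apply: val_inj.
have f_onJ x : exists r, f (g (i r)) = f x.
  have [r rE] := quotmod_proj_surj (f x).
  have rJ : r \in J by apply/lrangeP; exists x; rewrite -rE.
  exists r; rewrite -rE; have := fk (exist _ r rJ); rewrite -gE.
  exact.
have fg0 : forall e, (f \o g) e = 0.
  apply: superfluous_range_eq0 i_small _ => e.
  have [r rE] := f_onJ (g e).
  by exists (i r) => //; apply/lrangeP; exists r.
by move=> x; have [r <-] := f_onJ x; apply: fg0.
Qed.

Theorem corollary7 (R : pzRingType) :
  right_hereditary R -> right_small_ring R -> right_almost_QF R.
Proof.
move=> R_her R_small M M_inj I f; exists \0 => x.
by rewrite (injective_to_cyclic_eq0 f R_her R_small M_inj) linear0.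
Qed.
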